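(* Let $R$ be an arbitrary (possibly non-commutative) ring with $1$ and let $A\in\mathrm{M}_3(R)$. Then there exist $3\times 3$ matrices $C_i,D_i$ $(0\le i\le 3)$ with entries in $[R,R]$ such that $$(-\mathrm{sdet}(A)I+C_0)+\left(3(\mathrm{tr}^{2}(A)-\mathrm{tr}(A^{2}))I+C_1\right)A+(-6\,\mathrm{tr}(A)I+C_2)A^{2}+(6I+C_3)A^{3}=0$$ and $$(-\mathrm{sdet}(A)I+D_0)+A\left(3(\mathrm{tr}^{2}(A)-\mathrm{tr}(A^{2}))I+D_1\right)+A^{2}(-6\,\mathrm{tr}(A)I+D_2)+A^{3}(6I+D_3)=0.$$
   Context: $[R,R]$ is the additive subgroup of $R$ generated by all commutators $[u,v]=uv-vu$, $u,v\in R$. $I$ is the $3\times3$ identity matrix, $\mathrm{tr}$ denotes the sum of the diagonal entries and $\mathrm{tr}^2(A)=(\mathrm{tr}(A))^2$. For $A=[a_{i,j}]\in\mathrm{M}_n(R)$, the symmetric determinant is $$\mathrm{sdet}(A)=\sum_{\alpha,\beta\in\mathrm{S}_n}\mathrm{sgn}(\alpha)\,\mathrm{sgn}(\beta)\,a_{\alpha(1),\beta(1)}\cdots a_{\alpha(n),\beta(n)},$$ where $\mathrm{S}_n$ is the symmetric group on $\{1,\dots,n\}$. *)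

(* Defs.v *)
From mathcomp Require Import all_boot all_order all_fingroup all_algebra.

Set Implicit Arguments.
Unset Strict Implicit.
Unset Printing Implicit Defensive.

Import GRing.Theory.
Local Open Scope ring_scope.

Inductive commutator_subgroup (R : pzRingType) : R -> Prop :=
| commutator_subgroup_gen u v : commutator_subgroup (u * v - v * u)
| commutator_subgroup0 : commutator_subgroup 0
| commutator_subgroupD x y :
    commutator_subgroup x -> commutator_subgroup y -> commutator_subgroup (x + y)
| commutator_subgroupN x : commutator_subgroup x -> commutator_subgroup (- x).

Definition commutator_entries (R : pzRingType) (m n : nat) (C : 'M[R]_(m, n)) : Prop :=
  forall i j, commutator_subgroup (C i j).

(* [R] need not be commutative: the factors of the product are taken in
   increasing order of [i]. *)
Definition sdet (R : pzRingType) (n : nat) (A : 'M[R]_n) : R :=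
  \sum_(alpha : 'S_n) \sum_(beta : 'S_n)
    (-1) ^+ alpha * (-1) ^+ beta * \prod_(i < n) A (alpha i) (beta i).

(* Main.v *)
Require Import Defs.
From mathcomp Require Import all_boot all_order all_fingroup all_algebra.

Set Implicit Arguments.
Unset Strict Implicit.
Unset Printing Implicit Defensive.

Import GRing.Theory.
Local Open Scope ring_scope.

(** Over a commutative ring, the theorem is the Cayley-Hamilton identity
    multiplied by 6, and it comes from [\adj A * A = (\det A)%:M] once [\adj A]
    is written as a polynomial in [A].  The same two steps survive over a
    noncommutative ring when equality of entries is replaced by congruence
    modulo the additive group [R,R].  As [R,R] is not an ideal, congruent factors
    cannot be substituted inside a product, but a whole product may be rotated
    cyclically, because [x * y - y * x] lies in [R,R].

    The adjugate is replaced by [sadj A], built from the symmetric determinants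
    of the minors.

    - [sdet_sadj]: in size [n], [(sadj A * A) *+ n] is [(sdet A)%:M] modulo
      [R,R].  The terms of [sdet A] in which column [i] is used at position [m]
      are obtained from those in which it is used at the last position by
      rotating the products, so each of the [n] positions contributes the same
      class; and the terms with column [i] last add up to the diagonal entry
      [(sadj A * A) i i].  An off-diagonal entry is a diagonal entry for a matrix
      with two equal columns, whose symmetric determinant is zero.
      Transposition, which leaves [sdet] unchanged, gives [A * sadj A].
    - [sadj3]: in size 3, [sadj A] is exactly
      [tr(A)^2 - tr(A^2) - tr(A) A - A tr(A) + A^2 + A'], where [A'] is [A^2]
      computed with its entrywise products reversed.

    Modulo [R,R] the entries of [tr(A) A] and [A tr(A)] agree, and so do those
    of [A^2] and [A'], so [sadj A *+ 3] is
    [3 (tr(A)^2 - tr(A^2)) - 6 tr(A) A + 6 A^2] up to a matrix with entries in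
    [R,R].  That matrix is taken as the correction [C1] of the linear
    coefficient; it turns the polynomial without constant term into exactly
    [(sadj A *+ 3) * A], and [sdet_sadj] says that the constant term then needs
    a correction [C0] with entries in [R,R] only.  The corrections [C2] and [C3]
    are zero.  The second identity is obtained in the same way from
    [A * sadj A], with [A tr(A)] in place of [tr(A) A]. *)

(** * The additive group generated by commutators *)

Section CommutatorSubgroup.
Variable R : pzRingType.
Implicit Types x y z : R.

Lemma commutator_subgroupMn x n :
  commutator_subgroup x -> commutator_subgroup (x *+ n).
Proof.
move=> cx; elim: n => [|n IHn]; first by rewrite mulr0n; constructor.
by rewrite mulrS; constructor.
Qed.

Lemma commutator_subgroup_sum (I : Type) (r : seq I) (P : pred I) (F : I -> R) :
  (forall i, P i -> commutator_subgroup (F i)) ->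
  commutator_subgroup (\sum_(i <- r | P i) F i).
Proof. by move=> cF; elim/big_ind: _ => //; constructor. Qed.

Lemma commutator_subgroup_trans x y z :
  commutator_subgroup (x - y) -> commutator_subgroup (y - z) ->
  commutator_subgroup (x - z).
Proof. by move=> cxy cyz; rewrite -(subrKA y x (- z)); constructor. Qed.

Lemma commutator_subgroup_sign (b : bool) x :
  commutator_subgroup x -> commutator_subgroup ((-1) ^+ b * x).
Proof. by case: b => cx; rewrite ?mulN1r ?mul1r //; constructor. Qed.

(** Moving the first factor [x] of a product [x * y] to the end changes it by
    the single commutator [x * y - y * x]. *)
Lemma commutator_subgroup_rot n (F : 'I_n.+1 -> R) :
  commutator_subgroup (\prod_k F k - \prod_k F (ordS k)).
Proof.
rewrite big_ord_recl big_ord_recr /=.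
have -> : ordS ord_max = ord0 :> 'I_n.+1 by apply: val_inj; rewrite /= modnn.
rewrite (eq_bigr (fun k => F (ordS (widen_ord (leqnSn n) k)))); first by constructor.
by move=> k _; congr F; apply: val_inj; rewrite /= modn_small ?ltnS.
Qed.

Lemma commutator_entriesMn m n (C : 'M[R]_(m, n)) p :
  commutator_entries C -> commutator_entries (C *+ p).
Proof. by move=> cC i j; rewrite mulmxnE; apply: commutator_subgroupMn. Qed.

Lemma commutator_entries0 m n : commutator_entries (0 : 'M[R]_(m, n)).
Proof. by move=> i j; rewrite mxE; constructor. Qed.

End CommutatorSubgroup.

(** * Symmetric determinant and symmetric adjugate *)

Section SymmetricDeterminant.
Variable R : pzRingType.

(** The roles of [alpha] and [beta] are exchanged; the order of the factors is
    the order of the positions, which transposition does not affect. *)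
Lemma sdet_tr n (A : 'M[R]_n) : sdet A^T = sdet A.
Proof.
rewrite /sdet exchange_big; apply: eq_bigr => alpha _; apply: eq_bigr => beta _.
congr (_ * _); first by rewrite -!signr_addb addbC.
by apply: eq_bigr => i _; rewrite mxE.
Qed.

(** Composing [beta] with the transposition of the two equal columns pairs the
    odd permutations with the even ones, and paired terms are opposite.  Pairing
    is needed because [sdet A = - sdet A] would only give [sdet A *+ 2 = 0]. *)
Lemma sdet_alternate n (A : 'M[R]_n) j1 j2 :
  j1 != j2 -> (forall i, A i j1 = A i j2) -> sdet A = 0.
Proof.
move=> neq_j eqA; rewrite /sdet big1 // => alpha _; pose t := tperm j1 j2.
rewrite (bigID (@odd_perm _)) /= addrC (reindex_inj (mulIg t)) /=.
have odd_t (beta : 'S_n) : odd_perm (beta * t)%g = ~~ beta.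
  by rewrite odd_permM odd_tperm neq_j addbT.
rewrite (eq_bigl (@odd_perm _)) => [|beta]; last by rewrite odd_t negbK.
rewrite -big_split big1 //= => beta odd_beta.
rewrite odd_t odd_beta /= mulr1 mulrN1 mulNr.
rewrite (eq_bigr (fun i => A (alpha i) (beta i))) ?subrr // => i _.
by rewrite permM /t; case: tpermP => [->|->|//]; rewrite eqA.
Qed.

(** Permutations with a prescribed value at one point are the permutations of
    the remaining points; this is what turns sums over permutations into
    minors. *)
Lemma big_lift_perm n (F : 'S_n.+1 -> R) (i j : 'I_n.+1) :
  \sum_(s : 'S_n.+1 | s i == j) F s = \sum_(t : 'S_n) F (lift_perm i j t).
Proof.
have lift_perm_inj : injective (@lift_perm n i j).
  move=> t1 t2 /permP eq_t; apply/permP=> k; apply: (@lift_inj _ j).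
  by rewrite -!(lift_perm_lift i) eq_t.
rewrite -[RHS]big_imset /=; last by move=> t1 t2 _ _ /lift_perm_inj.
apply: eq_bigl => s; apply/eqP/imsetP => [si | [t _ ->]]; last exact: lift_perm_id.
have lt_s k : {k' | s (lift i k) = lift j k'}.
  have : j != s (lift i k) by rewrite -si (inj_eq perm_inj) neq_lift.
  by case/unlift_some => k' ->; exists k'.
have inj_s : injective (fun k => sval (lt_s k)).
  move=> k1 k2 /(congr1 (lift j)).
  by case: (lt_s k1) (lt_s k2) => ? e1 [? e2] /=; rewrite -e1 -e2 => /perm_inj/lift_inj.
exists (perm inj_s) => //; apply/permP=> k.
case: (unliftP i k) => [k'|] ->; rewrite ?lift_perm_id //.
by rewrite lift_perm_lift permE; case: (lt_s k').
Qed.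

(** Over a commutative ring this is [\adj A *+ n`!] in size [n.+1], since each
    minor is counted once for every order of its factors. *)
Definition sadj n (A : 'M[R]_n.+1) : 'M[R]_n.+1 :=
  \matrix_(i, k) ((-1) ^+ (i + k) * sdet (row' k (col' i A))).

Lemma sadj_tr n (A : 'M[R]_n.+1) : sadj A^T = (sadj A)^T.
Proof.
apply/matrixP=> i k; rewrite !mxE addnC -[in RHS]sdet_tr; congr (_ * sdet _).
by apply/matrixP=> p q; rewrite !mxE.
Qed.

(** The part of [sdet A] whose products have their factor from column [i] at
    position [m]. *)
Definition sdet_at n (A : 'M[R]_n.+1) (m i : 'I_n.+1) : R :=
  \sum_(alpha : 'S_n.+1) \sum_(beta : 'S_n.+1 | beta m == i)
    (-1) ^+ alpha * (-1) ^+ beta * \prod_(k < n.+1) A (alpha k) (beta k).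

(** When column [i] comes last, its factor [A k i] stands on the right of the
    product and can be factored out; what remains for each row [k] is the
    symmetric determinant of the minor without row [k] and column [i]. *)
Lemma sdet_at_last n (A : 'M[R]_n.+1) i :
  sdet_at A ord_max i = (sadj A * A) i i.
Proof.
rewrite mxE /sdet_at (partition_big (fun alpha : 'S_n.+1 => alpha ord_max) xpredT) //=.
apply: eq_bigr => k _; rewrite mxE /sdet big_lift_perm -mulrA big_distrl big_distrr /=.
apply: eq_bigr => s _; rewrite big_lift_perm big_distrl big_distrr /=.
apply: eq_bigr => t _; rewrite big_ord_recr /= !lift_perm_id !mulrA.
congr (_ * _ * _); last first.
  apply: eq_bigr => m _; rewrite !mxE.
  have -> : widen_ord (leqnSn n) m = lift ord_max m by apply/val_inj/esym/lift_max.
  by rewrite !lift_perm_lift.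
rewrite !odd_lift_perm -[(-1) ^+ (i + k)]signr_odd -!signr_addb oddD; congr (_ ^+ _).
by case: (odd _) (odd i) (odd k) (odd_perm s) (odd_perm t) => [] [] [] [] [].
Qed.

(** Shifting the positions by one composes both permutations with the same
    cycle, whose two signs cancel, and rotates each product. *)
Lemma sdet_at_ordS n (A : 'M[R]_n.+1) m i :
  commutator_subgroup (sdet_at A (ordS m) i - sdet_at A m i).
Proof.
pose c := perm (@ordS_inj n.+1).
rewrite {2}/sdet_at (reindex_inj (mulgI c)) /= /sdet_at -sumrB.
apply: commutator_subgroup_sum => alpha _.
rewrite [X in _ - X](reindex_inj (mulgI c)) /=.
rewrite [X in _ - X](eq_bigl (fun beta : 'S_n.+1 => beta (ordS m) == i)); last first.
  by move=> beta; rewrite permM permE.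
rewrite -sumrB; apply: commutator_subgroup_sum => beta _.
rewrite -!signr_addb !odd_permM addbACA addbb addFb -mulrBr.
apply: commutator_subgroup_sign.
rewrite [X in _ - X](eq_bigr (fun k => A (alpha (ordS k)) (beta (ordS k)))); last first.
  by move=> k _; rewrite !permM !permE.
exact: (commutator_subgroup_rot (fun k => A (alpha k) (beta k))).
Qed.

Lemma sdet_at_ord0 n (A : 'M[R]_n.+1) m i :
  commutator_subgroup (sdet_at A m i - sdet_at A ord0 i).
Proof.
case: m => m; elim: m => [|m IHm] lt_m.
  by rewrite (_ : Ordinal lt_m = ord0) ?subrr; [constructor | apply: val_inj].
apply: commutator_subgroup_trans (IHm (ltnW lt_m)).
rewrite (_ : Ordinal lt_m = ordS (Ordinal (ltnW lt_m))); first exact: sdet_at_ordS.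
by apply: val_inj; rewrite /= modn_small.
Qed.

Lemma sdet_sadj_diag n (A : 'M[R]_n.+1) i :
  commutator_subgroup (sdet A - (sadj A * A) i i *+ n.+1).
Proof.
have -> : sdet A = \sum_(m < n.+1) sdet_at A m i.
  rewrite /sdet_at exchange_big; apply: eq_bigr => alpha _ /=.
  rewrite (partition_big (fun beta : 'S_n.+1 => (beta^-1)%g i) xpredT) //=.
  apply: eq_bigr => m _; apply: eq_bigl => beta.
  by rewrite (canF_eq (permKV beta)) eq_sym.
rewrite -sdet_at_last -[n.+1 in X in _ - X]card_ord -sumr_const -sumrB.
apply: commutator_subgroup_sum => m _.
apply: commutator_subgroup_trans (sdet_at_ord0 A m i) _.
by rewrite -opprB; apply/commutator_subgroupN/sdet_at_ord0.
Qed.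

(** Off the diagonal, [(sadj A * A) i j] does not see column [i] of [A]
    inside [sadj A], so that column may be overwritten by column [j]: the entry
    becomes a diagonal one, for a matrix [B] with [sdet B = 0]. *)
Lemma sdet_sadj n (A : 'M[R]_n.+1) :
  commutator_entries ((sdet A)%:M - (sadj A * A) *+ n.+1).
Proof.
move=> i j; rewrite 2!mxE [X in _ + X]mxE mulmxnE.
have [<-|neq_ij] := eqVneq i j; first by rewrite mulr1n; apply: sdet_sadj_diag.
pose B := \matrix_(p, q) (if q == i then A p j else A p q).
have sdetB : sdet B = 0.
  by apply: (sdet_alternate neq_ij) => p; rewrite !mxE eqxx eq_sym (negPf neq_ij).
have -> : (sadj A * A) i j = (sadj B * B) i i.
  rewrite !mxE; apply: eq_bigr => s _; rewrite !mxE eqxx; congr (_ * sdet _ * _).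
  by apply/matrixP=> p q; rewrite !mxE eq_sym (negPf (neq_lift _ _)).
by rewrite mulr0n -{1}sdetB; apply: sdet_sadj_diag.
Qed.

(** Each product [A i k * sadj A k j] is congruent to [sadj A k j * A i k],
    which occurs in [sadj A^T * A^T]. *)
Lemma sdet_sadj_right n (A : 'M[R]_n.+1) :
  commutator_entries ((sdet A)%:M - (A * sadj A) *+ n.+1).
Proof.
move=> i j; have := sdet_sadj A^T j i.
rewrite 2!mxE [X in _ + X]mxE mulmxnE sdet_tr sadj_tr eq_sym => c_tr.
rewrite 2!mxE [X in _ + X]mxE mulmxnE; apply: commutator_subgroup_trans c_tr _.
rewrite -mulrnBl; apply: commutator_subgroupMn; rewrite !mxE -sumrB.
by apply: commutator_subgroup_sum => k _; rewrite !mxE; constructor.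
Qed.

End SymmetricDeterminant.

(** * The symmetric adjugate in size three *)

Section DegreeThree.
Variable R : pzRingType.

Lemma big_S2 (F : 'S_2 -> R) : \sum_s F s = F 1%g + F (tperm 0 1).
Proof.
have t_neq1 : (1%g : 'S_2) != tperm 0 1.
  by apply/eqP => /permP/(_ 0); rewrite perm1 tpermL.
have defS2 : [set: 'S_2] = [set 1%g; tperm 0 1].
  by apply/esym/eqP; rewrite eqEcard subsetT cardsT card_Sn cards2 t_neq1.
rewrite (eq_bigl (mem [set: 'S_2])) => [|s]; last by rewrite /= inE.
by rewrite defS2 big_setU1 ?big_set1 // inE.
Qed.

Lemma sdet2 (B : 'M[R]_2) :
  sdet B = B 0 0 * B 1 1 + B 1 1 * B 0 0 - (B 0 1 * B 1 0 + B 1 0 * B 0 1).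
Proof.
have prod2 (s t : 'S_2) :
  \prod_(i < 2) B (s i) (t i) = B (s 0) (t 0) * B (s 1) (t 1).
  rewrite big_ord_recl big_ord1.
  by rewrite (_ : lift ord0 ord0 = 1) //; apply: val_inj.
rewrite /sdet big_S2 !big_S2 !prod2 !odd_tperm !odd_perm1 /= !perm1 !tpermL !tpermR.
rewrite !mul1r !mulr1 mulrNN !mul1r !mulN1r.
by rewrite [X in _ + X = _]addrC addrACA -opprD.
Qed.

Definition ord3_seq : seq 'I_3 := [:: 0; 1; 2%:R].

(** An explicit list of indices lets identities between sums be checked by
    computation on the lists of their terms. *)
Lemma big_ord3 (F : 'I_3 -> R) : \sum_i F i = \sum_(i <- ord3_seq) F i.
Proof.
rewrite !big_ord_recl big_ord0 !big_cons big_nil.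
by congr (F _ + (F _ + (F _ + _))); apply: val_inj.
Qed.

(** Both sides of [sadj3] are sums of products of two entries of [A], and they
    agree without any commutation.  A product is recorded by the positions of
    its two factors, so that the identity reduces to the equality of two finite
    multisets of words. *)
Definition words (A : 'M[R]_3) (s : seq ('I_3 * 'I_3 * ('I_3 * 'I_3))) : R :=
  \sum_(w <- s) A w.1.1 w.1.2 * A w.2.1 w.2.2.

(** The two diagonal ([b = true]) or the two antidiagonal ([b = false])
    products of the minor entering [sadj A i k]. *)
Definition minor_words (b : bool) (i k : 'I_3) :=
  let p := lift k 0 in let q := lift k 1 in
  let r := lift i 0 in let s := lift i 1 in
  if b then [:: ((p, r), (q, s)); ((q, s), (p, r))]
  else [:: ((p, s), (q, r)); ((q, r), (p, s))].

Lemma sadj_words A i k :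
  sadj A i k + words A (minor_words (odd (i + k)) i k)
  = words A (minor_words (~~ odd (i + k)) i k).
Proof.
rewrite mxE sdet2 !mxE -signr_odd /minor_words /words.
by case: odd; rewrite /= ?mul1r ?mulN1r ?opprB !big_cons big_nil !addr0 subrK.
Qed.

Lemma words_cat A s1 s2 : words A (s1 ++ s2) = words A s1 + words A s2.
Proof. exact: big_cat. Qed.

Lemma words_if A (b : bool) s : words A (if b then s else [::]) = words A s *+ b.
Proof. by case: b => //; rewrite /words big_nil. Qed.

Lemma words_perm_eq A s1 s2 : perm_eq s1 s2 -> words A s1 = words A s2.
Proof. exact: perm_big. Qed.

Lemma words_map A (f : 'I_3 -> 'I_3 * 'I_3 * ('I_3 * 'I_3)) :
  words A [seq f p | p <- ord3_seq]
  = \sum_p A (f p).1.1 (f p).1.2 * A (f p).2.1 (f p).2.2.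
Proof. by rewrite /words big_map -big_ord3. Qed.

Lemma words_allpairs A (f : 'I_3 -> 'I_3 -> 'I_3 * 'I_3 * ('I_3 * 'I_3)) :
  words A [seq f p q | p <- ord3_seq, q <- ord3_seq]
  = \sum_p \sum_q A (f p q).1.1 (f p q).1.2 * A (f p q).2.1 (f p q).2.2.
Proof.
rewrite /words big_allpairs_dep /= -big_ord3.
by apply: eq_bigr => p _; rewrite -big_ord3.
Qed.

Lemma mul_scalar_mxE n (a : R) (A : 'M[R]_n) i k : (a%:M * A) i k = a * A i k.
Proof. by rewrite -mulmxE mul_scalar_mx mxE. Qed.

Lemma mul_mx_scalarE n (a : R) (A : 'M[R]_n) i k : (A * a%:M) i k = A i k * a.
Proof.
by rewrite -diag_const_mx -mulmxE mul_mx_diag !mxE.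
Qed.

(** Negative terms are moved to the other side, which leaves two lists of
    words [lhs i k] and [rhs i k] for each entry [(i, k)]; the nine pairs of lists
    are compared by computation.  The last matrix is the square of [A] with
    reversed products. *)
Lemma sadj3 (A : 'M[R]_3) :
  sadj A + ((\tr (A ^+ 2))%:M + (\tr A)%:M * A + A * (\tr A)%:M)
  = (\tr A ^+ 2)%:M + A ^+ 2 + \matrix_(i, k) \sum_p A p k * A i p.
Proof.
apply/matrixP=> i k.
pose tr2 := [seq ((p, p), (q, q)) | p <- ord3_seq, q <- ord3_seq].
pose trsq := [seq ((p, q), (q, p)) | p <- ord3_seq, q <- ord3_seq].
pose tr_l (i k : 'I_3) := [seq ((p, p), (i, k)) | p <- ord3_seq].
pose tr_r (i k : 'I_3) := [seq ((i, k), (p, p)) | p <- ord3_seq].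
pose sq (i k : 'I_3) := [seq ((i, p), (p, k)) | p <- ord3_seq].
pose qs (i k : 'I_3) := [seq ((p, k), (i, p)) | p <- ord3_seq].
pose lhs (i k : 'I_3) := minor_words (~~ odd (i + k)) i k ++
  ((if i == k then trsq else [::]) ++ tr_l i k ++ tr_r i k).
pose rhs (i k : 'I_3) := ((if i == k then tr2 else [::]) ++ sq i k ++ qs i k)
  ++ minor_words (odd (i + k)) i k.
have E : words A (lhs i k) = words A (rhs i k).
  apply: words_perm_eq.
  have /allP h : all (fun i => all (fun k => perm_eq (lhs i k) (rhs i k)) ord3_seq) ord3_seq.
    by vm_compute.
  have in_seq3 j : j \in ord3_seq by case: j => [[|[|[|]]]].
  exact: (allP (h i (in_seq3 i))).
move: E; rewrite !words_cat !words_if -sadj_words addrAC => /addIr.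
rewrite !words_allpairs !words_map /=.
rewrite -mulr_suml -mulr_sumr -/(\tr A) => E.
have addE (B C : 'M[R]_3) : (B + C) i k = B i k + C i k by rewrite mxE.
have scalarE (a : R) : a%:M i k = a *+ (i == k) by rewrite mxE.
rewrite !addE mul_scalar_mxE mul_mx_scalarE !scalarE -!addrA.
rewrite (_ : (A ^+ 2) i k = \sum_p A i p * A p k); last by rewrite expr2 mxE.
rewrite (_ : \tr (A ^+ 2) = \sum_p \sum_q A p q * A q p); last first.
  by apply: eq_bigr => p _; rewrite expr2 mxE.
rewrite [(\matrix_(_, _) _) i k]mxE expr2 big_distrlr.
exact: E.
Qed.

(** With [x = sadj A], [z - y] the scalar part, [s] and [v] the square of [A] and
    its reversed version, and [p], [q] the two products of [A] with its trace:
    replacing [v] by [s] and [q] by [p] costs [v - s] and [p - q], whose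
    entries are sums of commutators. *)
Lemma zmod_regroup (V : zmodType) (x z s v y p q : V) :
  x + (y + p + q) = z + s + v ->
  x - (z - y - p *+ 2 + s *+ 2) = (v - s) + (p - q).
Proof.
move=> /(canRL (addrK _)) ->.
have -> : z + s + v - (y + p + q) = (z - y) + (s + v - (p + q)).
  by rewrite -(addrA z s v) -(addrA y p q) opprD addrACA.
rewrite -[z - y - _ + _]addrA [- (z - y + _)]opprD addrACA subrr add0r !mulr2n !opprD !opprK.
(* The left side is now [s + v - p - q + (p + p - s - s)]. *)
by rewrite [LHS](AC (2*2*(2*2)) ((1*7)*(2*8)*(3*5)*(6*4)))%AC /= subrr addNr add0r addr0.
Qed.

Lemma sadj3_sub_l (A : 'M[R]_3) :
  commutator_entries (sadj A - ((\tr A ^+ 2 - \tr (A ^+ 2))%:M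
                               - ((\tr A)%:M * A) *+ 2 + A ^+ 2 *+ 2)).
Proof.
rewrite raddfB /= (zmod_regroup (sadj3 A)) => i k.
rewrite mxE; constructor.
  rewrite mxE [X in X + _]mxE [X in _ + X]mxE expr2 [X in - X]mxE -sumrB.
  by apply: commutator_subgroup_sum => p _; constructor.
by rewrite mxE [X in _ + X]mxE mul_scalar_mxE mul_mx_scalarE; constructor.
Qed.

Lemma sadj3_sub_r (A : 'M[R]_3) :
  commutator_entries (sadj A - ((\tr A ^+ 2 - \tr (A ^+ 2))%:M
                               - (A * (\tr A)%:M) *+ 2 + A ^+ 2 *+ 2)).
Proof.
move: (sadj3 A); rewrite addrAC => /zmod_regroup; rewrite raddfB => -> i k.
rewrite mxE; constructor.
  rewrite mxE [X in X + _]mxE [X in _ + X]mxE expr2 [X in - X]mxE -sumrB.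
  by apply: commutator_subgroup_sum => p _; constructor.
by rewrite mxE [X in _ + X]mxE mul_scalar_mxE mul_mx_scalarE; constructor.
Qed.

End DegreeThree.

(** * The Cayley-Hamilton identities *)

Theorem corollary6p5 (R : pzRingType) (A : 'M[R]_3) :
  exists C0 C1 C2 C3 D0 D1 D2 D3 : 'M[R]_3,
    [/\ commutator_entries C0, commutator_entries C1,
        commutator_entries C2 & commutator_entries C3] /\
    [/\ commutator_entries D0, commutator_entries D1,
        commutator_entries D2 & commutator_entries D3] /\
    ((- sdet A)%:M + C0)
      + ((3%:R * ((\tr A) ^+ 2 - \tr (A ^+ 2)))%:M + C1) * A
      + ((- (6%:R * \tr A))%:M + C2) * A ^+ 2
      + (6%:R%:M + C3) * A ^+ 3 = 0 /\
    ((- sdet A)%:M + D0)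
      + A * ((3%:R * ((\tr A) ^+ 2 - \tr (A ^+ 2)))%:M + D1)
      + A ^+ 2 * ((- (6%:R * \tr A))%:M + D2)
      + A ^+ 3 * (6%:R%:M + D3) = 0.
Proof.
set K := 3%:R * _; set T := 6%:R * _.
have KE : K%:M = (\tr A ^+ 2 - \tr (A ^+ 2))%:M *+ 3 :> 'M[R]_3.
  by rewrite /K mulr_natl raddfMn.
have TE : T%:M = (\tr A)%:M *+ 6 :> 'M[R]_3 by rewrite /T mulr_natl raddfMn.
have natE p : p%:R%:M = p%:R :> 'M[R]_3 by rewrite raddfMn.
have cancelK (S P Q : 'M[R]_3) : K%:M + (S - (K%:M - P + Q)) = S + (P - Q).
  by rewrite -[K%:M - P + Q]addrA opprD addrCA addNKr opprD opprK.
exists ((sdet A)%:M - (sadj A * A) *+ 3).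
exists (sadj A *+ 3 - (K%:M - T%:M * A + A ^+ 2 *+ 6)).
exists 0, 0.
exists ((sdet A)%:M - (A * sadj A) *+ 3).
exists (sadj A *+ 3 - (K%:M - A * T%:M + A ^+ 2 *+ 6)).
exists 0, 0.
split; last split; last split.
- split; [exact: sdet_sadj | | exact: commutator_entries0..].
  have -> : sadj A *+ 3 - (K%:M - T%:M * A + A ^+ 2 *+ 6) =
    (sadj A - ((\tr A ^+ 2 - \tr (A ^+ 2))%:M
       - ((\tr A)%:M * A) *+ 2 + A ^+ 2 *+ 2)) *+ 3.
    by rewrite mulrnBl mulrnDl mulrnBl -!mulrnA KE TE mulrnAl.
  exact/commutator_entriesMn/sadj3_sub_l.
- split; [exact: sdet_sadj_right | | exact: commutator_entries0..].
  have -> : sadj A *+ 3 - (K%:M - A * T%:M + A ^+ 2 *+ 6) =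
    (sadj A - ((\tr A ^+ 2 - \tr (A ^+ 2))%:M
       - (A * (\tr A)%:M) *+ 2 + A ^+ 2 *+ 2)) *+ 3.
    by rewrite mulrnBl mulrnDl mulrnBl -!mulrnA KE TE mulrnAr.
  exact/commutator_entriesMn/sadj3_sub_r.
- rewrite !addr0 natE !raddfN /= addKr cancelK mulrDl mulrBl !mulrnAl.
  rewrite -mulrA -expr2 -exprSr mulNr mul1r addKr.
  by rewrite addrAC subrK subrr.
- rewrite !addr0 natE !raddfN /= addKr cancelK mulrDr mulrBr !mulrnAr.
  rewrite mulrA -expr2 -exprS mulrN mulr1 addKr.
  by rewrite addrAC subrK subrr.
Qed.
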